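(* Let $X\subseteq\mathbb{Z}^{\mathbb{N}}$. Then $X$ has the Menger (respectively, Scheepers, Hurewicz, Rothberger) property if, and only if, each continuous image $Y$ of $X$ in $\mathbb{Z}^{\mathbb{N}}$ (that is, $Y=\Psi[X]$ for a continuous $\Psi:X\to\mathbb{Z}^{\mathbb{N}}$) is Menger-bounded (respectively, Scheepers-bounded, Hurewicz-bounded, Rothberger-bounded).
   Context: $\mathbb{N}=\{0,1,2,\dots\}$, $[0,m)=\{0,\dots,m-1\}$, $\mathbb{Z}^{<\aleph_0}$ is the set of finite sequences of integers, and $\mathbb{Z}^{\mathbb{N}}$ has the product topology ($\mathbb{Z}$ discrete). Topological properties of a space $X$. Menger property: for each sequence $(\mathcal{U}_n)_{n\in\mathbb{N}}$ of open covers of $X$ there are finite $\mathcal{F}_n\subseteq\mathcal{U}_n$ such that $\bigcup_n\mathcal{F}_n$ covers $X$. Scheepers property: for each such sequence there are finite $\mathcal{F}_n\subseteq\mathcal{U}_n$ such that for each finite $F\subseteq X$ there is $n$ with $F\subseteq\bigcup_{U\in\mathcal{F}_n}U$. Hurewicz property: for each such sequence there are finite $\mathcal{F}_n\subseteq\mathcal{U}_n$ such that for each $x\in X$, $x\in\bigcup_{U\in\mathcal{F}_n}U$ for all but finitely many $n$. Rothberger property: for each such sequence there are $U_n\in\mathcal{U}_n$ such that $X=\bigcup_n U_n$. Boundedness properties of an arbitrary subset $Y$ of $\mathbb{Z}^{\mathbb{N}}$. - $Y$ is Menger-bounded if there is $f\in\mathbb{N}^{\mathbb{N}}$ such that for every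 $g\in Y$ there are infinitely many $n$ with $|g(k)|\le f(n)$ for all $k\in[0,n)$. - $Y$ is Scheepers-bounded if there is $f\in\mathbb{N}^{\mathbb{N}}$ such that for every finite $F\subseteq Y$ there are infinitely many $n$ such that $|g(k)|\le f(n)$ for all $g\in F$ and all $k\in[0,n)$. - $Y$ is Hurewicz-bounded if there is $f\in\mathbb{N}^{\mathbb{N}}$ such that for every $g\in Y$, $|g(n)|\le f(n)$ for all but finitely many $n$. - $Y$ is Rothberger-bounded if for each strictly increasing $h\in\mathbb{N}^{\mathbb{N}}$ there is $\varphi:\mathbb{N}\to\mathbb{Z}^{<\aleph_0}$ such that for every $g\in Y$ there exists $n$ with $g\upharpoonright[0,h(n))=\varphi(n)$. *)

(* Defs.v *)
From HB Require Import structures.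
From mathcomp Require Import all_boot all_order all_algebra.
From mathcomp Require Import all_classical all_reals topology.

Set Implicit Arguments.
Unset Strict Implicit.
Unset Printing Implicit Defensive.

Local Open Scope classical_set_scope.

Definition Zseq : Type := prod_topology (fun _ : nat => discrete_topology int).

HB.instance Definition _ := Topological.on Zseq.

Definition Zcoord (g : Zseq) (k : nat) : int := g k.

(* Nonemptiness follows from covering unless T is empty. It rules out the
   empty family as a cover of the empty space, from which no member could be
   selected in the Rothberger property. *)
Definition open_cover (T : topologicalType) (U : set (set T)) : Prop :=
  [/\ U !=set0, U `<=` open & \bigcup_(V in U) V = [set: T]].

Definition finite_selection (T : Type) (U F : nat -> set (set T)) : Prop :=
  forall n, finite_set (F n) /\ F n `<=` U n.

Definition Menger (T : topologicalType) : Prop :=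
  forall U : nat -> set (set T), (forall n, open_cover (U n)) ->
  exists F, finite_selection U F /\
    \bigcup_n \bigcup_(V in F n) V = [set: T].

Definition Scheepers (T : topologicalType) : Prop :=
  forall U : nat -> set (set T), (forall n, open_cover (U n)) ->
  exists F, finite_selection U F /\
    forall A : set T, finite_set A ->
      exists n, A `<=` \bigcup_(V in F n) V.

Definition Hurewicz (T : topologicalType) : Prop :=
  forall U : nat -> set (set T), (forall n, open_cover (U n)) ->
  exists F, finite_selection U F /\
    forall x : T, \forall n \near \oo, (\bigcup_(V in F n) V) x.

Definition Rothberger (T : topologicalType) : Prop :=
  forall U : nat -> set (set T), (forall n, open_cover (U n)) ->
  exists V : nat -> set T, (forall n, U n (V n)) /\ \bigcup_n V n = [set: T].

Definition Menger_bounded (Y : set Zseq) : Prop :=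
  exists f : nat -> nat, forall g, Y g ->
    infinite_set [set n | forall k, (k < n)%N -> (`|Zcoord g k| <= f n)%N].

Definition Scheepers_bounded (Y : set Zseq) : Prop :=
  exists f : nat -> nat, forall A : set Zseq, finite_set A -> A `<=` Y ->
    infinite_set [set n | forall g, A g ->
      forall k, (k < n)%N -> (`|Zcoord g k| <= f n)%N].

Definition Hurewicz_bounded (Y : set Zseq) : Prop :=
  exists f : nat -> nat, forall g, Y g ->
    \forall n \near \oo, (`|Zcoord g n| <= f n)%N.

Definition Rothberger_bounded (Y : set Zseq) : Prop :=
  forall h : nat -> nat, {homo h : m n / (m < n)%N} ->
  exists phi : nat -> seq int, forall g, Y g ->
    exists n, mkseq (Zcoord g) (h n) = phi n.

(* set_type X carries the subspace topology. *)
Definition continuous_images (X : set Zseq) (P : set Zseq -> Prop) : Prop :=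
  forall Psi : set_type X -> Zseq, continuous Psi -> P (range Psi).

(* Main.v *)
(* If Psi : X -> Z^N is continuous, the sets of points whose first n coordinates
   under Psi are bounded by m, for m in N, form an increasing open cover of X,
   and selecting finitely many of them amounts to choosing a bound f(n).
   Conversely, a sequence of open covers of X is turned into one continuous map
   Psi: coordinate n of Psi(x) encodes the shortest prefix of x whose cylinder
   lies in a member of the n-th cover. A bound on, or a guess of, coordinate n
   then selects finitely many members, or a single member, of that cover. *)
Require Import Defs.
From mathcomp Require Import all_boot all_order all_algebra.
From mathcomp Require Import all_classical all_reals topology.

Set Implicit Arguments.
Unset Strict Implicit.
Unset Printing Implicit Defensive.

Local Open Scope classical_set_scope.

(** * Infinite sets of naturals and finite subsets of images *)

Lemma infinite_set_natP (A : set nat) :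
  infinite_set A <-> forall j, exists2 n, (j <= n)%N & A n.
Proof.
split=> [infA j|unbA /finite_seqP[s As]].
  apply: contra_notP infA => noA; apply: (@sub_finite_set _ _ `I_j) => // n An.
  by rewrite /= ltnNge; apply/negP => jn; apply: noA; exists n.
have [n + An] := unbA (\max_(i <- s) i).+1.
rewrite ltnNge => /negP; apply; apply: (leq_bigmax_seq n) => //.
by move: An; rewrite As.
Qed.

Lemma finite_set_sub_image (T T' : Type) (f : T -> T') (A : set T)
    (B : set T') :
  finite_set B -> B `<=` f @` A ->
  exists C, [/\ finite_set C, C `<=` A & f @` C = B].
Proof.
move=> finB BfA.
(* When [B] is empty, [A] may be empty too. Otherwise some [a0] in [A] exists and serves as default
   value outside [B] for the choice of preimages. *)
have [->|/set0P[b0 Bb0]] := eqVneq B set0.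
  by exists set0; split=> //; rewrite image_set0.
have [a0 Aa0 _] := BfA _ Bb0.
have /choice[g gP] y : exists x, B y -> A x /\ f x = y.
  have [/BfA[x Ax fx]|nBy] := pselect (B y); first by exists x.
  by exists a0.
exists (g @` B); split; first exact: finite_image.
  by move=> _ [y /gP[Ay _] <-].
rewrite eqEsubset; split=> [_ [_ [y By <-] <-]|y By].
  by have [_ ->] := gP y By.
by exists (g y); [exists y|have [] := gP y By].
Qed.

(** * Finite prefixes and the product topology *)

Lemma take_mkseq (T : Type) (f : nat -> T) (m n : nat) :
  (m <= n)%N -> take m (mkseq f n) = mkseq f m.
Proof. by move=> mn; rewrite /mkseq -map_take take_iota (minn_idPl mn). Qed.

Lemma eq_mkseq_leq (T : Type) (f g : nat -> T) (m n : nat) : (m <= n)%N ->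
  mkseq f n = mkseq g n -> mkseq f m = mkseq g m.
Proof. by move=> mn fg; rewrite -(take_mkseq f mn) fg take_mkseq. Qed.

Lemma eq_mkseq_nth (T : Type) (f g : nat -> T) (n k : nat) : (k < n)%N ->
  mkseq f n = mkseq g n -> f k = g k.
Proof. by move=> kn fg; rewrite -(nth_mkseq (f k) f kn) fg nth_mkseq. Qed.

(** The product topology is the supremum of the topologies induced by the coordinates, and
    singletons are open in the discrete factors. *)
Lemma cvg_ZseqP (F : set_system Zseq) (x : Zseq) : Filter F ->
  F --> x <-> forall k, \forall y \near F, Zcoord y k = Zcoord x k.
Proof.
move=> FF; have sup := cvg_sup (fun k => Topological.class
  (initial_topology (fun f : Zseq => (f k : discrete_topology int)))) x FF.
split=> [/sup Fx k|Fx].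
  apply: (Fx k); exists [set y | Zcoord y k = Zcoord x k]; split=> //.
  exists [set Zcoord x k] => //.
  exact: (@discrete_open (discrete_topology int)).
apply/sup => k A [_ [[B _ <-] Bx BA]].
apply: filterS (Fx k) => y yx.
by apply: BA; rewrite /preimage /= -[y k]/(Zcoord y k) yx.
Qed.

Lemma near_mkseq (T : topologicalType) (Psi : T -> Zseq) (n : nat) :
  continuous Psi -> forall x : T,
  \forall y \near x, mkseq (Zcoord (Psi y)) n = mkseq (Zcoord (Psi x)) n.
Proof.
move=> cPsi x; have /cvg_ZseqP Psix := cPsi x.
elim: n => [|n IHn]; first exact: nearW.
by apply: filterS2 IHn (Psix n) => y yx yxn; rewrite !mkseqS yx yxn.
Qed.

(** The cylinders around [x] generate a filter. It converges to [x] coordinatewise, hence contains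
    every neighbourhood of [x]. *)
Lemma nbhs_mkseq (x : Zseq) (A : set Zseq) : nbhs x A ->
  exists m, forall y, mkseq (Zcoord y) m = mkseq (Zcoord x) m -> A y.
Proof.
pose cyl m := [set y | mkseq (Zcoord y) m = mkseq (Zcoord x) m].
have FF : Filter (filter_from setT cyl).
  apply: filter_fromT_filter => [|i j]; first by exists 0%N.
  by exists (maxn i j) => y yx; split; apply: eq_mkseq_leq yx;
    rewrite (leq_maxl, leq_maxr).
suff Fx : filter_from setT cyl --> x by move=> /Fx[m _ mA]; exists m.
apply/cvg_ZseqP => k; exists k.+1 => // y yx.
exact: eq_mkseq_nth yx.
Qed.

Lemma open_prefix (T : topologicalType) (Psi : T -> Zseq) (n : nat)
    (P : set (seq int)) : continuous Psi ->
  open [set x | P (mkseq (Zcoord (Psi x)) n)].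
Proof.
move=> cPsi; rewrite openE => x /= Px.
by apply: filterS (near_mkseq n cPsi x) => y /= ->.
Qed.

(** * From covering properties to bounded images *)

Definition bounded_prefix (T : Type) (Psi : T -> Zseq) (n m : nat) : set T :=
  [set x | forall k, (k < n)%N -> (`|Zcoord (Psi x) k| <= m)%N].

Lemma open_bounded_prefix (T : topologicalType) (Psi : T -> Zseq) (n m : nat) :
  continuous Psi -> open (bounded_prefix Psi n m).
Proof.
move=> /(@open_prefix _ Psi n
  [set s | forall k, (k < n)%N -> (`|nth 0%R s k| <= m)%N]).
by congr open; apply/seteqP; split=> x /= bx k kn; move: (bx k kn);
  rewrite nth_mkseq.
Qed.

Lemma open_cover_increasing (T : topologicalType) (V : nat -> set T) :
  (forall m, open (V m)) -> (forall x, exists m, V m x) ->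
  open_cover (range V).
Proof.
move=> oV cV; split; first by exists (V 0%N), 0%N.
  by move=> _ [m _ <-].
apply/seteqP; split=> x // _; have [m Vx] := cV x.
by exists (V m) => //; exists m.
Qed.

(** In an increasing family, the member of largest index absorbs a finite union. *)
Lemma finite_range_bound (T : Type) (V : nat -> set T) (F : set (set T)) :
  {homo V : m n / (m <= n)%N >-> m `<=` n} -> finite_set F -> F `<=` range V ->
  exists m, \bigcup_(W in F) W `<=` V m.
Proof.
move=> Vmono finF /(finite_set_sub_image finF)[C [/finite_seqP[s Cs] _ <-]].
exists (\max_(i <- s) i) => x [_ [i Ci <-] Vx].
apply: Vmono Vx; apply: (leq_bigmax_seq i) => //.
by move: Ci; rewrite Cs.
Qed.

Lemma selection_bound (T : Type) (V : nat -> nat -> set T)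
    (F : nat -> set (set T)) :
  (forall n, {homo V n : m p / (m <= p)%N >-> m `<=` p}) ->
  finite_selection (fun n => range (V n)) F ->
  exists f : nat -> nat, forall n, \bigcup_(W in F n) W `<=` V n (f n).
Proof.
move=> Vmono selF.
have /choice[f fP] n : exists m, \bigcup_(W in F n) W `<=` V n m.
  by have [finF FV] := selF n; apply: finite_range_bound.
by exists f.
Qed.

(* Diagonalization over the tails of the sequence of covers. *)
Lemma infinitely_often (T : Type) (V : nat -> nat -> set T)
    (AA : set (set T)) :
  (forall n, {homo V n : m p / (m <= p)%N >-> m `<=` p}) ->
  (forall j, exists f : nat -> nat, forall A, AA A ->
     exists n, A `<=` V (j + n)%N (f n)) ->
  exists f : nat -> nat, forall A, AA A ->
    infinite_set [set n | A `<=` V n (f n)].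
Proof.
move=> Vmono /choice[g gP].
(* At index [j + n] the maximum includes the term [g j n], so this one function dominates the
   solution for every tail. *)
exists (fun n => \max_(j < n.+1) g j (n - j)%N) => A /gP gA.
apply/infinite_set_natP => j; have [n An] := gA j.
exists (j + n)%N => /=; first exact: leq_addr.
apply: subset_trans An _; apply: Vmono.
have jn : (j < (j + n).+1)%N by rewrite ltnS leq_addr.
by apply: (bigmax_sup (Ordinal jn)) => //=; rewrite addKn.
Qed.

Lemma bounded_prefix_mono (T : Type) (Psi : T -> Zseq) (n : nat) :
  {homo bounded_prefix Psi n : m p / (m <= p)%N >-> m `<=` p}.
Proof. by move=> m p mp x bx k /bx km; apply: leq_trans km mp. Qed.

Lemma bounded_prefix_cover (T : topologicalType) (Psi : T -> Zseq) (n : nat) :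
  continuous Psi -> open_cover (range (bounded_prefix Psi n)).
Proof.
move=> cPsi; apply: open_cover_increasing => [m|x].
  exact: open_bounded_prefix.
exists (\max_(k < n) `|Zcoord (Psi x) k|%N) => k kn.
exact: (bigmax_sup (Ordinal kn)).
Qed.

(* Menger and Scheepers are the cases where [AA] consists of the singletons,
   resp. the finite sets. *)
Lemma selection_bounded_prefix (T : topologicalType) (AA : set (set T))
    (Psi : T -> Zseq) :
  (forall U : nat -> set (set T), (forall n, open_cover (U n)) ->
     exists F, finite_selection U F /\
       forall A, AA A -> exists n, A `<=` \bigcup_(V in F n) V) ->
  continuous Psi ->
  exists f : nat -> nat, forall A, AA A ->
    infinite_set [set n | A `<=` bounded_prefix Psi n (f n)].
Proof.
move=> selT cPsi.
apply: infinitely_often => [n|j]; first exact: bounded_prefix_mono.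
have [F [selF FA]] := selT (fun n => range (bounded_prefix Psi (j + n)))
  (fun n => bounded_prefix_cover (j + n) cPsi).
have [f fP] := selection_bound
  (fun n => @bounded_prefix_mono _ Psi (j + n)) selF.
by exists f => A /FA[n An]; exists n; apply: subset_trans An (fP n).
Qed.

Lemma Menger_range (T : topologicalType) (Psi : T -> Zseq) :
  Menger T -> continuous Psi -> Menger_bounded (range Psi).
Proof.
move=> MT cPsi.
have [|f fP] := @selection_bounded_prefix _ (range set1) Psi _ cPsi.
  move=> U /MT[F [selF covF]]; exists F; split=> // _ [x _ <-].
  have : [set: T] x by [].
  by rewrite -covF => -[n _ Vx]; exists n => _ ->.
exists f => _ [x _ <-].
apply: sub_infinite_set (fP [set x] _); last by exists x.
by move=> n; exact.
Qed.

Lemma Scheepers_range (T : topologicalType) (Psi : T -> Zseq) :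
  Scheepers T -> continuous Psi -> Scheepers_bounded (range Psi).
Proof.
move=> ST cPsi.
have [//|f fP] := @selection_bounded_prefix _ finite_set Psi _ cPsi.
exists f => A finA /(finite_set_sub_image finA)[B [finB _ <-]].
apply: sub_infinite_set (fP B finB).
by move=> n /= Bn _ [x /Bn xn <-].
Qed.

Lemma Hurewicz_range (T : topologicalType) (Psi : T -> Zseq) :
  Hurewicz T -> continuous Psi -> Hurewicz_bounded (range Psi).
Proof.
move=> HT cPsi; have [F [selF FP]] := HT
  (fun n => range (bounded_prefix Psi n.+1))
  (fun n => bounded_prefix_cover n.+1 cPsi).
have [f fP] := selection_bound (fun n => @bounded_prefix_mono _ Psi n.+1) selF.
exists f => _ [x _ <-]; apply: filterS (FP x) => n /fP; exact.
Qed.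

(** Prefixes of length [h n] split the space into open pieces, and selecting one piece amounts to
    guessing the prefix. *)
Lemma Rothberger_range (T : topologicalType) (Psi : T -> Zseq) :
  Rothberger T -> continuous Psi -> Rothberger_bounded (range Psi).
Proof.
move=> RT cPsi h _; pose C n s := [set x | mkseq (Zcoord (Psi x)) (h n) = s].
have [|V [UV covV]] := RT (fun n => range (C n)).
  (* An explicit member, possibly empty, keeps the family nonempty even when [T] has no points. *)
  move=> n; split; first by exists (C n [::]), [::].
    by move=> _ [s _ <-]; apply: (@open_prefix _ Psi _ [set s]).
  apply/seteqP; split=> x // _.
  by exists (C n (mkseq (Zcoord (Psi x)) (h n))) => //; eexists.
have /choice[phi phiP] n : exists s, C n s = V n.
  by have [s _ <-] := UV n; exists s.
exists phi => _ [x _ <-]; have : [set: T] x by [].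
by rewrite -covV => -[n _]; rewrite -phiP => Vx; exists n.
Qed.

(** * Coding open covers by a continuous map *)

Lemma open_cover_code (X : set Zseq) (U : set (set (set_type X))) :
  open_cover U ->
  exists (psi : set_type X -> nat) (W : nat -> set (set_type X)),
    [/\ forall x : set_type X, \forall y \near x, psi y = psi x,
        forall c, U (W c) & forall x, W (psi x) x].
Proof.
move=> [[V0 UV0] oU covU].
pose pre (x : set_type X) m := mkseq (Zcoord (set_val x)) m.
pose good s := exists2 V, U V & forall x, pre x (size s) = s -> V x.
(* A member of the cover containing [x] is the trace on [X] of an open set of sequences, which
   contains a cylinder around [x]. *)
have ex_good x : exists m, `[< good (pre x m) >].
  have : [set: set_type X] x by [].
  rewrite -covU => -[V UV Vx].
  have [A oA AV] := oU _ UV.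
  have [m mA] : exists m, forall y : Zseq,
      mkseq (Zcoord y) m = pre x m -> A y.
    apply: nbhs_mkseq; apply: open_nbhs_nbhs; split=> //.
    by rewrite -[A _]/((set_val @^-1` A) x) AV.
  exists m; apply/asboolP; exists V => // y; rewrite size_mkseq => /mA.
  by rewrite -AV.
pose len x := ex_minn (ex_good x).
have len_good x : good (pre x (len x)).
  by rewrite /len; case: ex_minnP => m /asboolP.
have len_min x m : good (pre x m) -> (len x <= m)%N.
  by move=> gm; rewrite /len; case: ex_minnP => k _; apply; apply/asboolP.
(* The shared prefix is good, so [len y <= len x]. The good prefix of [y] is then also a prefix of
   [x], and minimality of [len x] gives equality. Hence [psi] below is locally constant. *)
have len_eq x y : pre y (len x) = pre x (len x) -> len y = len x.
  move=> yx; have yx_le : (len y <= len x)%N by apply: len_min; rewrite yx.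
  have yx_len : pre y (len y) = pre x (len y) by exact: eq_mkseq_leq yx.
  by apply/eqP; rewrite eqn_leq yx_le /=; apply: len_min; rewrite -yx_len.
pose psi x := pickle (pre x (len x)).
(* As [pickle] is injective, all points with code [c] share one good prefix and so lie in one
   member. Codes that are not attained get the default [V0]. *)
have /choice[W WP] c : exists V, U V /\ forall x, psi x = c -> V x.
  have [[x <-]|noc] := pselect (exists x, psi x = c); last first.
    by exists V0; split=> // x xc; case: noc; exists x.
  have [V UV VP] := len_good x; exists V; split=> // y.
  move=> /(pcan_inj pickleK) yx; apply: VP; rewrite size_mkseq -yx.
  by congr pre; move: (congr1 size yx); rewrite !size_mkseq.
exists psi, W; split=> [x|c|x]; last 2 first.
- by have [] := WP c.
- by have [_] := WP (psi x); apply.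
have cval : continuous (set_val : set_type X -> Zseq).
  exact: initial_continuous.
apply: filterS (near_mkseq (len x) cval x) => y yx.
by rewrite /psi (len_eq _ _ yx) [pre y _]yx.
Qed.

Lemma open_covers_code (X : set Zseq) (U : nat -> set (set (set_type X))) :
  (forall n, open_cover (U n)) ->
  exists (Psi : set_type X -> Zseq) (W : nat -> nat -> set (set_type X)),
    [/\ continuous Psi, forall n c, U n (W n c) &
        forall n x, W n `|Zcoord (Psi x) n|%N x].
Proof.
move=> cU; have /choice[psi psiP] n := open_cover_code (cU n).
have /choice[W WP] := psiP.
(* Codes become nonnegative integers, so the absolute value of a coordinate returns the code. *)
exists (fun x n => Posz (psi n x)), W; split=> [x|n c|n x].
- apply/cvg_ZseqP => [|k].
    exact: (@fmap_filter _ Zseq _ (nbhs x) (@nbhs_filter (set_type X) x)).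
  rewrite near_map.
  by have [+ _ _] := WP k => /(_ x); apply: filterS => y /= yx; congr Posz.
- by have [_ UWn _] := WP n; exact: UWn.
- by have [_ _ Wx] := WP n; exact: Wx.
Qed.

Definition initial_selection (T : Type) (W : nat -> nat -> set T)
    (f : nat -> nat) (n : nat) : set (set T) :=
  W n @` [set c | (c <= f n)%N].

Lemma finite_initial_selection (T : Type) (U : nat -> set (set T))
    (W : nat -> nat -> set T) (f : nat -> nat) :
  (forall n c, U n (W n c)) -> finite_selection U (initial_selection W f).
Proof.
move=> UW n; split; last by move=> _ [c _ <-].
exact/finite_image/(finite_II (f n).+1).
Qed.

(** * From bounded images to covering properties *)

Lemma Menger_of_images (X : set Zseq) :
  continuous_images X Menger_bounded -> Menger (set_type X).
Proof.
move=> bX U /open_covers_code[Psi [W [cPsi UW WP]]].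
have [f fP] := bX _ cPsi.
(* The bound [f n.+1] concerns the coordinates below [n.+1], hence coordinate [n]. Infinitely many
   good indices provide a positive one, of the form [n.+1]. *)
exists (initial_selection W (fun n => f n.+1)).
split; first exact: finite_initial_selection.
apply/seteqP; split=> x // _.
have : range Psi (Psi x) by exists x.
move=> /fP/infinite_set_natP/(_ 1%N)[[//|n] _ xn].
exists n => //; exists (W n `|Zcoord (Psi x) n|%N) => //.
by exists `|Zcoord (Psi x) n|%N => //; exact: xn.
Qed.

Lemma Scheepers_of_images (X : set Zseq) :
  continuous_images X Scheepers_bounded -> Scheepers (set_type X).
Proof.
move=> bX U /open_covers_code[Psi [W [cPsi UW WP]]].
have [f fP] := bX _ cPsi.
exists (initial_selection W (fun n => f n.+1)).
split; first exact: finite_initial_selection.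
move=> A finA.
have : Psi @` A `<=` range Psi by move=> _ [x _ <-]; exists x.
move=> /(fP _ (finite_image Psi finA)).
move=> /infinite_set_natP /(_ 1%N)[[//|n] _ An].
(* The same index serves all points of [A] at once. *)
exists n => x Ax; exists (W n `|Zcoord (Psi x) n|%N) => //.
by exists `|Zcoord (Psi x) n|%N => //; apply: An => //; exists x.
Qed.

Lemma Hurewicz_of_images (X : set Zseq) :
  continuous_images X Hurewicz_bounded -> Hurewicz (set_type X).
Proof.
move=> bX U /open_covers_code[Psi [W [cPsi UW WP]]].
have [f fP] := bX _ cPsi.
(* Here [f n] bounds coordinate [n] itself, so the index is not shifted. *)
exists (initial_selection W f); split; first exact: finite_initial_selection.
move=> x; have : range Psi (Psi x) by exists x.
move=> /fP; apply: filterS => n xn.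
exists (W n `|Zcoord (Psi x) n|%N) => //.
by exists `|Zcoord (Psi x) n|%N.
Qed.

Lemma Rothberger_of_images (X : set Zseq) :
  continuous_images X Rothberger_bounded -> Rothberger (set_type X).
Proof.
move=> bX U /open_covers_code[Psi [W [cPsi UW WP]]].
(* A guessed prefix of length [n.+1] ends with coordinate [n], the code for the [n]-th cover. If
   [phi n] is too short, the default [0] still names a member of that cover. *)
have [//|phi phiP] := bX _ cPsi succn.
exists (fun n => W n `|nth 0%R (phi n) n|%N); split=> //.
apply/seteqP; split=> x // _.
have [|n xn] := phiP (Psi x); first by exists x.
by exists n => //; rewrite -xn nth_mkseq.
Qed.

Theorem theorem5p6 (X : set Zseq) :
  [/\ Menger (set_type X) <-> continuous_images X Menger_bounded,
      Scheepers (set_type X) <-> continuous_images X Scheepers_bounded,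
      Hurewicz (set_type X) <-> continuous_images X Hurewicz_bounded &
      Rothberger (set_type X) <-> continuous_images X Rothberger_bounded].
Proof.
split; split.
- by move=> MX Psi; apply: Menger_range.
- exact: Menger_of_images.
- by move=> SX Psi; apply: Scheepers_range.
- exact: Scheepers_of_images.
- by move=> HX Psi; apply: Hurewicz_range.
- exact: Hurewicz_of_images.
- by move=> RX Psi; apply: Rothberger_range.
- exact: Rothberger_of_images.
Qed.
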